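(* Let $\Lambda$ be a left hereditary ring, and suppose that the pair of morphism classes $(Epi, Mono)$ is a factorization system on the stable category $\Lambda\text{-}\underline{\mathrm{Mod}}$. Then either the injective envelope of the left module ${}_{\Lambda}\Lambda$ is projective or $\Lambda$ does not satisfy the descending chain condition on direct summands of ${}_{\Lambda}\Lambda$.
   Context: Rings are associative with identity; modules are left modules. The stable category $\Lambda\text{-}\underline{\mathrm{Mod}}$ has all left $\Lambda$-modules as objects; its morphisms are equivalence classes of $\Lambda$-homomorphisms, where $f$ and $g$ are equivalent if $f-g$ factors through a projective module. $Epi$ and $Mono$ denote the classes of all epimorphisms and all monomorphisms of the category. A factorization system in a category is a pair of morphism classes $(\mathbb{E},\mathbb{M})$, each containing all isomorphisms and closed under composition with isomorphisms, such that: (1) every morphism $\alpha$ can be written $\alpha=me$ with $e\in\mathbb{E}$, $m\in\mathbb{M}$; (2) for each $e:A\to B$ in $\mathbb{E}$, $m:C\to D$ in $\mathbb{M}$, and morphisms $\alpha:A\to C$, $\beta:B\to D$ with $\beta e=m\alpha$, there is a unique $\delta:B\to C$ with $\alpha=\delta e$ and $\beta=m\delta$. *)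

(* Defs.v *)
From HB Require Import structures.
From mathcomp Require Import all_boot all_algebra.
From mathcomp Require Import boolp.

Set Implicit Arguments.
Unset Strict Implicit.
Unset Printing Implicit Defensive.

Import GRing.Theory.
Local Open Scope ring_scope.
Local Open Scope quotient_scope.

Record category := Category {
  obj :> Type;
  hom : obj -> obj -> Type;
  cid : forall A, hom A A;
  ccomp : forall A B C, hom B C -> hom A B -> hom A C;
  cid_left : forall A B (f : hom A B), ccomp (cid B) f = f;
  cid_right : forall A B (f : hom A B), ccomp f (cid A) = f;
  ccomp_assoc : forall A B C D (h : hom C D) (g : hom B C) (f : hom A B),
    ccomp h (ccomp g f) = ccomp (ccomp h g) f
}.

Section CategoryNotions.
Variable C : category.

Definition morphism_class := forall A B : C, hom A B -> Prop.

Definition is_epi : morphism_class := fun A B f =>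
  forall (D : C) (g h : hom B D), ccomp g f = ccomp h f -> g = h.

Definition is_mono : morphism_class := fun A B f =>
  forall (D : C) (g h : hom D A), ccomp f g = ccomp f h -> g = h.

Definition is_iso : morphism_class := fun A B f =>
  exists g : hom B A, ccomp g f = cid A /\ ccomp f g = cid B.

Definition contains_isos (K : morphism_class) :=
  forall (A B : C) (f : hom A B), is_iso f -> K A B f.

Definition closed_under_isos (K : morphism_class) :=
  (forall (A A' B : C) (f : hom A B) (u : hom A' A),
     is_iso u -> K A B f -> K A' B (ccomp f u)) /\
  (forall (A B B' : C) (f : hom A B) (v : hom B B'),
     is_iso v -> K A B f -> K A B' (ccomp v f)).

Record factorization_system (E M : morphism_class) : Prop := {
  fs_isoE : contains_isos E;
  fs_isoM : contains_isos M;
  fs_closedE : closed_under_isos E;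
  fs_closedM : closed_under_isos M;
  fs_factor : forall (A B : C) (f : hom A B),
    exists (I : C) (e : hom A I) (m : hom I B),
      [/\ E A I e, M I B m & f = ccomp m e];
  fs_diagonal : forall (A B D F : C) (e : hom A B) (m : hom D F)
      (a : hom A D) (b : hom B F),
    E A B e -> M D F m -> ccomp b e = ccomp m a ->
    exists! d : hom B D, a = ccomp d e /\ b = ccomp m d
}.

End CategoryNotions.

Section Modules.
Variable R : pzRingType.
Implicit Types M N P U V W X : lmodType R.

Definition projective_module P :=
  forall M N (g : {linear M -> N}) (f : {linear P -> N}),
    (forall y, exists x, g x = y) ->
    exists h : {linear P -> M}, forall x, g (h x) = f x.

Definition injective_module (E : lmodType R) :=
  forall M N (i : {linear M -> N}) (f : {linear M -> E}),
    injective i ->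
    exists h : {linear N -> E}, forall x, h (i x) = f x.

Definition submodule M (S : submodClosed M) : Type := {x : M | x \in S}.

HB.instance Definition _ M (S : submodClosed M) :=
  SubChoice.on (submodule S).
HB.instance Definition _ M (S : submodClosed M) :=
  [SubChoice_isSubLmodule of submodule S by <:].

(* The submodules of M range over [submodClosed M], i.e. boolean predicates
   closed under the operations; in the presence of [boolp.asbool] this is no
   restriction. *)
Definition left_hereditary :=
  forall I : submodClosed R^o, projective_module (submodule I).

Definition essential M N (i : {linear M -> N}) :=
  forall S : submodClosed N, (exists2 y, y \in S & y != 0) ->
  exists2 x, i x \in S & i x != 0.

Definition injective_envelope M (E : lmodType R) (i : {linear M -> E}) :=
  [/\ injective_module E, injective i & essential i].

Definition direct_summand M (S : submodClosed M) :=
  exists T : submodClosed M,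
    (forall x, x \in S -> x \in T -> x = 0) /\
    (forall x, exists s t, [/\ s \in S, t \in T & x = s + t]).

Definition dcc_direct_summands M :=
  forall S : nat -> submodClosed M,
    (forall n, direct_summand (S n)) ->
    (forall n, {subset S n.+1 <= S n}) ->
    exists n, forall m, (n <= m)%N -> S m =i S n.

Definition factors_through_projective U V (f : U -> V) :=
  exists P (i : {linear U -> P}) (j : {linear P -> V}),
    projective_module P /\ forall x, f x = j (i x).

(* A copy of the type of linear maps carrying the (classical) choiceType
   structure that [generic_quotient] requires. *)
Definition modhom U V : Type := {linear U -> V}.

HB.instance Definition _ U V := gen_eqMixin (modhom U V).
HB.instance Definition _ U V := gen_choiceMixin (modhom U V).

Definition stably_eq U V (f g : modhom U V) : bool :=
  `[< factors_through_projective (fun x => f x - g x) >].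

Lemma linear_funP U V (f : U -> V) :
  linear f -> exists h : {linear U -> V}, h =1 f.
Proof.
move=> lf; pose m := GRing.isLinear.Build R U V *:%R f lf.
pose h : {linear U -> V} := HB.pack f m.
by exists h.
Qed.

Lemma projective0 : projective_module 'rV[R]_0.
Proof.
move=> M N g f _; have [h hE] : exists h : {linear 'rV[R]_0 -> M}, h =1 fun=> 0.
  by apply: linear_funP => a x y; rewrite scaler0 addr0.
by exists h => x; rewrite hE (thinmx0 x) !linear0.
Qed.

Lemma projective_prod P Q :
  projective_module P -> projective_module Q ->
  projective_module (P * Q)%type.
Proof.
move=> hP hQ M N g f g_surj.
have [f1 f1E] : exists h : {linear P -> N}, h =1 fun p => f (p, 0).
  apply: linear_funP => a x y; rewrite -linearP; congr (f _).
  by congr (_, _) => /=; rewrite scaler0 addr0.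
have [f2 f2E] : exists h : {linear Q -> N}, h =1 fun q => f (0, q).
  apply: linear_funP => a x y; rewrite -linearP; congr (f _).
  by congr (_, _) => /=; rewrite scaler0 addr0.
have [h1 h1E] := hP _ _ g f1 g_surj; have [h2 h2E] := hQ _ _ g f2 g_surj.
have [h hE] : exists h : {linear (P * Q)%type -> M},
    h =1 fun x => h1 x.1 + h2 x.2.
  by apply: linear_funP => a x y /=; rewrite !linearP scalerDr addrACA.
exists h => -[p q]; rewrite hE linearD h1E h2E f1E f2E -linearD.
by congr (f (_, _)) => /=; rewrite ?addr0 ?add0r.
Qed.

Lemma ftp_zero U V : factors_through_projective (fun _ : U => 0 : V).
Proof.
have [i iE] : exists i : {linear U -> 'rV[R]_0}, i =1 fun=> 0.
  by apply: linear_funP => a x y; rewrite scaler0 addr0.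
have [j jE] : exists j : {linear 'rV[R]_0 -> V}, j =1 fun=> 0.
  by apply: linear_funP => a x y; rewrite scaler0 addr0.
by exists 'rV[R]_0, i, j; split=> [|x]; [exact: projective0 | rewrite jE].
Qed.

Lemma ftp_opp U V (f : U -> V) :
  factors_through_projective f ->
  factors_through_projective (fun x => - f x).
Proof.
move=> [P [i [j [hP fE]]]].
have [k kE] : exists k : {linear P -> V}, k =1 fun x => - j x.
  by apply: linear_funP => a x y; rewrite linearP opprD scalerN.
by exists P, i, k; split=> // x; rewrite kE fE.
Qed.

Lemma ftp_add U V (f g : U -> V) :
  factors_through_projective f -> factors_through_projective g ->
  factors_through_projective (fun x => f x + g x).
Proof.
move=> [P [i [j [hP fE]]]] [Q [k [l [hQ gE]]]].
have [u uE] : exists u : {linear U -> (P * Q)%type}, u =1 fun x => (i x, k x).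
  by apply: linear_funP => a x y; rewrite !linearP.
have [v vE] : exists v : {linear (P * Q)%type -> V},
    v =1 fun x => j x.1 + l x.2.
  by apply: linear_funP => a x y /=; rewrite !linearP scalerDr addrACA.
exists (P * Q)%type, u, v; split; first exact: projective_prod.
by move=> x; rewrite vE uE fE gE.
Qed.

Lemma ftp_comp U V W X (f : {linear U -> V}) (g : V -> W) (h : {linear W -> X}) :
  factors_through_projective g ->
  factors_through_projective (fun x => h (g (f x))).
Proof.
move=> [P [i [j [hP gE]]]].
by exists P, (i \o f), (h \o j); split=> // x /=; rewrite gE.
Qed.

Lemma ftp_eq U V (f g : U -> V) : f =1 g ->
  factors_through_projective f -> factors_through_projective g.
Proof. by move=> fg [P [i [j [hP fE]]]]; exists P, i, j; split=> // x; rewrite -fg. Qed.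

Lemma stably_eqP U V (f g : modhom U V) :
  reflect (factors_through_projective (fun x => f x - g x)) (stably_eq f g).
Proof. exact: asboolP. Qed.

Lemma stably_eq_refl U V : reflexive (@stably_eq U V).
Proof.
move=> f; apply/stably_eqP; apply: ftp_eq (ftp_zero U V) => x.
by rewrite subrr.
Qed.

Lemma stably_eq_sym U V : symmetric (@stably_eq U V).
Proof.
move=> f g; apply/stably_eqP/stably_eqP => /ftp_opp; apply: ftp_eq => x;
  by rewrite opprB.
Qed.

Lemma stably_eq_trans U V : transitive (@stably_eq U V).
Proof.
move=> g f h /stably_eqP fg /stably_eqP gh; apply/stably_eqP.
by apply: ftp_eq (ftp_add fg gh) => x; rewrite addrA subrK.
Qed.

Canonical stably_eq_equiv U V :=
  EquivRel (@stably_eq U V) (@stably_eq_refl U V) (@stably_eq_sym U V)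
    (@stably_eq_trans U V).

Definition stable_hom U V : Type := {eq_quot (@stably_eq U V)}.

Definition stable_class U V (f : {linear U -> V}) : stable_hom U V :=
  \pi_{eq_quot (@stably_eq U V)} (f : modhom U V).

Definition stable_repr U V (a : stable_hom U V) : {linear U -> V} :=
  repr (a : {eq_quot (@stably_eq U V)}).

Lemma stable_reprK U V : cancel (@stable_repr U V) (@stable_class U V).
Proof. exact: reprK. Qed.

Lemma stable_class_eq U V (f g : {linear U -> V}) :
  stable_class f = stable_class g <->
  factors_through_projective (fun x => f x - g x).
Proof.
by split=> [/eqmodP/stably_eqP//|fg]; apply/eqmodP/stably_eqP.
Qed.

Definition stable_id U : stable_hom U U := stable_class idfun.

Definition stable_comp U V W (b : stable_hom V W) (a : stable_hom U V) :
    stable_hom U W :=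
  stable_class (stable_repr b \o stable_repr a).

Lemma stable_comp_class U V W (g : {linear V -> W}) (f : {linear U -> V}) :
  stable_comp (stable_class g) (stable_class f) = stable_class (g \o f).
Proof.
apply/stable_class_eq => /=.
set g' := stable_repr _; set f' := stable_repr _.
have /stable_class_eq gg : stable_class g' = stable_class g.
  exact: stable_reprK.
have /stable_class_eq ff : stable_class f' = stable_class f.
  exact: stable_reprK.
have := ftp_add (ftp_comp f' idfun gg) (ftp_comp idfun g ff).
by apply: ftp_eq => x /=; rewrite linearB addrA subrK.
Qed.

Lemma eq_stable_class U V (f g : {linear U -> V}) :
  f =1 g -> stable_class f = stable_class g.
Proof.
move=> fg; apply/stable_class_eq; apply: ftp_eq (ftp_zero U V) => x.
by rewrite fg subrr.
Qed.

Lemma stable_comp1l U V (a : stable_hom U V) :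
  stable_comp (stable_id V) a = a.
Proof.
rewrite -[a]stable_reprK stable_comp_class; exact: eq_stable_class.
Qed.

Lemma stable_comp1r U V (a : stable_hom U V) :
  stable_comp a (stable_id U) = a.
Proof.
rewrite -[a]stable_reprK stable_comp_class; exact: eq_stable_class.
Qed.

Lemma stable_compA U V W X (c : stable_hom W X) (b : stable_hom V W)
    (a : stable_hom U V) :
  stable_comp c (stable_comp b a) = stable_comp (stable_comp c b) a.
Proof.
rewrite -[a]stable_reprK -[b]stable_reprK -[c]stable_reprK.
by rewrite !stable_comp_class; exact: eq_stable_class.
Qed.

Definition stable_category : category :=
  Category stable_comp1l stable_comp1r stable_compA.

End Modules.

(* Main.v *)
(* Let E be an injective envelope of R, with i : R -> E. For a linear map q from
   E to a projective module, let S(q) be the left ideal ker (q i); since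
   quotients of injectives are injective over a hereditary ring, S(q) is a
   direct summand of R, so the descending chain condition provides a minimal
   one, S. The projection p : E -> E / i(S) is stably mono, because S is
   projective, and stably epi, because by minimality every map from E to a
   projective module vanishes on i(S), hence factors through p. As (Epi, Mono)
   is a factorization system, p has a stable retraction g. Then id - g p
   factors through a projective module, so it vanishes on i(S); but it is the
   identity there, so S = 0. By essentiality some q is injective, and it splits
   as E is injective, so E is projective. *)
Require Import Defs.
From HB Require Import structures.
From mathcomp Require Import all_boot all_algebra.
From mathcomp Require Import boolp classical_sets functions.

Set Implicit Arguments.
Unset Strict Implicit.
Unset Printing Implicit Defensive.

Import GRing.Theory Num.Theory.
Local Open Scope ring_scope.

(** * Submodules, quotient modules and Baer's criterion *)

Section LinearAlgebra.
Variable R : pzRingType.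
Implicit Types M N V : lmodType R.

Lemma submod_of_pred V (P : V -> Prop) :
  P 0 -> (forall a x y, P x -> P y -> P (a *: x + y)) ->
  exists S : submodClosed V, forall x, x \in S <-> P x.
Proof.
move=> P0 PD; pose p : {pred V} := fun x => `[< P x >].
have hp : submod_closed p.
  by split=> [|a x y /asboolP px /asboolP py]; apply/asboolP => //; apply: PD.
pose m := GRing.isSubmodClosed.Build R V p (GRing.submod_closed_semi hp).
pose S : submodClosed V := HB.pack (p : V -> bool) m.
by exists S => x; split=> [/asboolP|px]; last apply/asboolP.
Qed.

(* The library instances of [rpredN] and [rpredB] do not apply to
   [submodClosed], which also covers modules over semirings. *)
Lemma submodN V (S : submodClosed V) x : x \in S -> - x \in S.
Proof. by move=> xS; rewrite -scaleN1r rpredZ. Qed.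

Lemma submodB V (S : submodClosed V) x y : x \in S -> y \in S -> x - y \in S.
Proof. by move=> xS yS; rewrite rpredD ?submodN. Qed.

Section Quotient.
Variables (V : lmodType R) (S : submodClosed V).

Let p : {pred V} := fun x => x \in S.

Let p_closed : zmod_closed p.
Proof. by split=> [|x y]; [exact: rpred0 | exact: submodB]. Qed.

Let pm := GRing.isZmodClosed.Build V p p_closed.

Let Z : zmodClosed V := HB.pack (p : V -> bool) pm.

Definition lquot : Type := Quotient.quot Z.
HB.instance Definition _ := GRing.Zmodule.on lquot.

Definition lquot_pi (x : V) : lquot := (\pi_(Quotient.quot Z) x)%qT.

Lemma lquot_pi_eq x y : lquot_pi x = lquot_pi y <-> x - y \in S.
Proof.
have -> : (x - y \in S) = (x - y \in Z) by [].
by rewrite Quotient.idealrBE; split=> /eqP.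
Qed.

(** Scales a chosen representative; [lquot_piZ] shows that the class does not depend on the
    choice. *)
Definition lquot_scale (a : R) (x : lquot) : lquot :=
  lquot_pi (a *: repr (x : Quotient.quot Z)).

Lemma lquot_piP (x : lquot) : exists y, x = lquot_pi y.
Proof. by exists (repr (x : Quotient.quot Z)); rewrite /lquot_pi reprK. Qed.

Lemma lquot_piD x y : lquot_pi (x + y) = lquot_pi x + lquot_pi y.
Proof. exact: Quotient.pi_add. Qed.

Lemma lquot_piZ a x : lquot_pi (a *: x) = lquot_scale a (lquot_pi x).
Proof.
apply/lquot_pi_eq; rewrite -scalerBr rpredZ //.
by apply/lquot_pi_eq; rewrite {2}/lquot_pi reprK.
Qed.

Lemma lquot_scaleA a b v :
  lquot_scale a (lquot_scale b v) = lquot_scale (a * b) v.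
Proof. by have [x ->] := lquot_piP v; rewrite -!lquot_piZ scalerA. Qed.

Lemma lquot_scale1 : left_id 1 lquot_scale.
Proof. by move=> v; have [x ->] := lquot_piP v; rewrite -!lquot_piZ scale1r. Qed.

Lemma lquot_scaleDr : right_distributive lquot_scale +%R.
Proof.
move=> a u v; have [x ->] := lquot_piP u; have [y ->] := lquot_piP v.
by rewrite -!lquot_piZ -!lquot_piD -lquot_piZ scalerDr.
Qed.

Lemma lquot_scaleDl v : {morph lquot_scale^~ v : a b / a + b}.
Proof.
by move=> a b; have [x ->] := lquot_piP v; rewrite -!lquot_piZ -lquot_piD scalerDl.
Qed.

HB.instance Definition _ := GRing.Zmodule_isLmodule.Build R lquot
  lquot_scaleA lquot_scale1 lquot_scaleDr lquot_scaleDl.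

End Quotient.

Lemma quotient_module V (S : submodClosed V) :
  exists (Q : lmodType R) (p : {linear V -> Q}),
    (forall y, exists x, p x = y) /\ (forall x, p x = 0 <-> x \in S).
Proof.
have [p pE] : exists p : {linear V -> lquot S}, p =1 @lquot_pi V S.
  by apply: linear_funP => a x y; rewrite lquot_piD lquot_piZ.
exists (lquot S), p; split=> [y|x].
  by have [x ->] := lquot_piP y; exists x.
by rewrite -(linear0 p) !pE lquot_pi_eq subr0.
Qed.

(* [B] need not be closed under anything; both Baer's criterion (graphs of
   partial maps avoid the nonzero pairs [(0, e)]) and essential extensions
   are instances. *)
Lemma maximal_avoiding V (S0 : submodClosed V) (B : V -> Prop) :
  (forall x, x \in S0 -> ~ B x) ->
  exists S : submodClosed V, [/\ {subset S0 <= S},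
    forall x, x \in S -> ~ B x &
    forall v, v \notin S -> exists s a, s \in S /\ B (s + a *: v)].
Proof.
move=> avoid0.
pose good (A : set V) (S : submodClosed V) :=
  [/\ {subset S0 <= S}, forall x, x \in S -> ~ B x & forall x, A x <-> x \in S].
pose P (A : set V) := (forall x, ~ A x) \/ exists S, good A S.
have [A [PA Amax]] : exists A, P A /\ forall B, (A `<` B)%classic -> ~ P B.
  apply: Zorn_bigcup => F FP Ftot.
  have [[A [FA [a Aa]]]|F0] := pselect (exists A, F A /\ exists a, A a); last first.
    by left=> x [A FA Ax]; apply: F0; exists A; split=> //; exists x.
  right.
  have goodF C c : F C -> C c -> exists S, good C S.
    by move=> /FP[/(_ c)|].
  have [S [S0S avS AS]] := goodF _ _ FA Aa.
  have [||T TE] := @submod_of_pred V (fun x => (\bigcup_(X in F) X)%classic x).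
  - by exists A => //; apply/AS; rewrite rpred0.
  - move=> r x y [X FX Xx] [Y FY Yy].
    have [XY|YX] := Ftot _ _ FX FY.
      have [U [_ _ UE]] := goodF _ _ FY Yy; exists Y => //; apply/UE.
      by rewrite rpredD ?rpredZ //; apply/UE => //; apply: XY.
    have [U [_ _ UE]] := goodF _ _ FX Xx; exists X => //; apply/UE.
    by rewrite rpredD ?rpredZ //; apply/UE => //; apply: YX.
  exists T; split=> [x xS0|x /TE[X FX Xx]|x].
  - by apply/TE; exists A => //; apply/AS/S0S.
  - by have [U [_ + UE]] := goodF _ _ FX Xx; apply; apply/UE.
  - by split=> [h|/TE//]; apply/TE.
have [A0|[S [S0S avS AS]]] := PA.
  case: (Amax (fun x => x \in S0)).
    split=> [x /A0//|h].
    by apply: (A0 0); apply: h; rewrite rpred0.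
  by right; exists S0; split.
exists S; split=> // v vS; apply: contrapT => noB.
(* If [v] violated the last claim, [S + R v] would be a larger submodule avoiding [B]. *)
have [||T TE] := @submod_of_pred V
    (fun x => exists s a, s \in S /\ x = s + a *: v).
- by exists 0, 0; rewrite rpred0 scale0r addr0.
- move=> r _ _ [s [a [sS ->]]] [t [b [tS ->]]].
  exists (r *: s + t), (r * a + b); split; first by rewrite rpredD ?rpredZ.
  by rewrite scalerDr scalerDl scalerA addrACA.
have ST : {subset S <= T}.
  by move=> x xS; apply/TE; exists x, 0; rewrite scale0r addr0.
case: (Amax (fun x => x \in T)).
  split=> [x /AS/ST//|h].
  move/negP: vS; apply; apply/AS/h/TE.
  by exists 0, 1; rewrite rpred0 scale1r add0r.
right; exists T; split=> [x /S0S/ST//|x /TE[s [a [sS xE]]] Bx|x //].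
by apply: noB; exists s, a; rewrite -xE.
Qed.

(** A map on a left ideal extends to [R] exactly when it has this form, [e] being the image of
    [1]. *)
Definition baer_injective (E : lmodType R) :=
  forall (I : submodClosed R^o) (f : {linear submodule I -> E}),
  exists e, forall x, f x = (val x : R) *: e.

(** A maximal graph [G] of a partial map [N -> E] containing all [(i x, f x)] is total. Asking only
    that [f] vanish on the kernel of [i] makes the result usable for non-injective [i]. *)
Lemma baer_extend (E : lmodType R) : baer_injective E ->
  forall M N (i : {linear M -> N}) (f : {linear M -> E}),
    (forall x, i x = 0 -> f x = 0) ->
    exists h : {linear N -> E}, forall x, h (i x) = f x.
Proof.
move=> hE M N i f kerif.
have [||G0 G0E] := @submod_of_pred (N * E)%type
    (fun p => exists x, p = (i x, f x)).
- by exists 0; rewrite !linear0.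
- by move=> a _ _ [x ->] [y ->]; exists (a *: x + y); rewrite !linearP.
pose B (p : (N * E)%type) := p.1 = 0 /\ p.2 <> 0.
have [|G [G0G avG Gmax]] := @maximal_avoiding (N * E)%type G0 B.
  by move=> p /G0E[x ->] [/= /kerif ->].
have Gfun n e e' : (n, e) \in G -> (n, e') \in G -> e = e'.
  move=> h h'; apply: contrapT => ee'.
  have := submodB h h'; move/avG; apply; split; rewrite /= ?subrr //.
  by move/eqP; rewrite subr_eq0 => /eqP.
have Gtot n : exists e, (n, e) \in G.
  apply: contrapT => nG.
  (* [I] is the left ideal of those [r] for which [r *: n] lies in the domain of [G]. *)
  have [||I IE] := @submod_of_pred R^o
      (fun r : R^o => exists e, ((r : R) *: n, e) \in G).
  - by exists 0; rewrite scale0r; exact: (rpred0 G).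
  - move=> a x y [e xe] [e' ye']; exists (a *: e + e').
    have := rpredD (rpredZ a xe) ye'.
    by rewrite scalerDl -scalerA.
  have [phi phiE] : {phi : submodule I -> E &
      forall x, ((val x : R) *: n, phi x) \in G}.
    apply: (@choice _ _ (fun (x : submodule I) e => ((val x : R) *: n, e) \in G)) => x.
    exact/IE/valP.
  have [f' f'E] : exists f' : {linear submodule I -> E}, f' =1 phi.
    apply: linear_funP => a x y; apply: (Gfun _ _ _ (phiE _)).
    have := rpredD (rpredZ a (phiE x)) (phiE y).
    by rewrite scalerDl -scalerA.
  have [e eE] := hE I f'.
  (* By maximality, adjoining [(n, e)] creates a pair [(0, d + a *: e)] with nonzero second entry;
     but then [a] is in [I] and [a *: e = - d]. *)
  have [|[m d] [a [mdG [/= m0 d0]]]] := Gmax (n, e).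
    by apply/negP => h; apply: nG; exists e.
  have anG : (a *: n, - d) \in G.
    have -> : a *: n = - m by apply/eqP; rewrite -addr_eq0 addrC m0.
    exact: submodN mdG.
  have aI : a \in I by apply/IE; exists (- d).
  pose x : submodule I := Sub a aI.
  have : phi x = - d by apply: (Gfun _ _ _ (phiE x)).
  by rewrite -f'E eE /= => ad; apply: d0; rewrite ad subrr.
have [h hG] := choice Gtot.
have [k kE] : exists k : {linear N -> E}, k =1 h.
  apply: linear_funP => a x y; apply: (Gfun _ _ _ (hG _)).
  exact: rpredD (rpredZ a (hG x)) (hG y).
exists k => x; rewrite kE; apply: (Gfun _ _ _ (hG _)).
by apply: G0G; apply/G0E; exists x.
Qed.

Lemma baer_is_injective (E : lmodType R) :
  baer_injective E -> injective_module E.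
Proof.
move=> hE M N i f inj_i; apply: baer_extend hE _ _ _ _ _ => x ix0.
by have -> : x = 0; [apply: inj_i; rewrite ix0 linear0 | rewrite linear0].
Qed.

Lemma injective_is_baer (E : lmodType R) :
  injective_module E -> baer_injective E.
Proof.
move=> hE I f.
have [j jE] : exists j : {linear submodule I -> R^o}, j =1 val.
  by apply: linear_funP => a x y.
have [|h hf] := hE _ _ j f; first by move=> x y; rewrite !jE => /val_inj.
exists (h 1) => x; rewrite -hf jE -linearZ.
by congr (h _); rewrite /GRing.scale /= mulr1.
Qed.

End LinearAlgebra.

(** * Divisible abelian groups, viewed as [int]-modules *)

Section DivisibleGroups.

Definition divisible (D : lmodType int) :=
  forall (n : int) (d : D), n != 0 -> exists e, n *: e = d.

(** Division with remainder by the least positive element; [m = 0] if there is none. *)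
Lemma int_submod_principal (I : submodClosed int^o) :
  exists2 m : int, (m : int^o) \in I &
    forall n : int, (n : int^o) \in I -> exists q, n = q * m.
Proof.
have [[n [nI n0]]|I0] :=
    pselect (exists n : int, (n : int^o) \in I /\ n != 0); last first.
  exists 0 => [|n nI]; first exact: rpred0.
  exists 0; rewrite mul0r; apply/eqP; apply: contrapT => /negP n0.
  by apply: I0; exists n.
pose P k := `[< (0 < k)%N /\ (k%:Z : int^o) \in I >].
have absI (k : int) : (k : int^o) \in I -> ((`|k|%N : int) : int^o) \in I.
  by move=> kI; case: (intP k) kI => [|m|m] //= /submodN; rewrite ?opprK.
have exP : exists k, P k.
  by exists `|n|%N; apply/asboolP; rewrite absz_gt0; split=> //; apply: absI.
case: (ex_minnP exP) => m /asboolP[m0 mI] mmin.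
exists m%:Z => // k kI; exists (k %/ m)%Z.
have rI : ((k %% m)%Z : int^o) \in I.
  rewrite /modz; apply: submodB => //.
  exact: (rpredZ (k %/ m)%Z mI).
have r0 : (k %% m)%Z = 0.
  apply/eqP; apply: contrapT => /negP rn0.
  have : P `|(k %% m)%Z|%N.
    by apply/asboolP; rewrite absz_gt0; split=> //; apply: absI.
  move/mmin; rewrite leqNgt -ltz_nat gez0_abs ?modz_ge0 ?ltz_pmod //.
  by rewrite eqz_nat -lt0n.
by rewrite {1}(divz_eq k m) r0 addr0.
Qed.

(** With [m] generating [I], any [e] such that [m *: e = f m] works. *)
Lemma divisible_baer (D : lmodType int) : divisible D -> baer_injective D.
Proof.
move=> divD I f; have [m mI mP] := int_submod_principal I.
have [m0|m0] := eqVneq m 0.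
  exists 0 => x; rewrite scaler0.
  have -> : x = 0.
    by apply: val_inj; have [q ->] := mP _ (valP x); rewrite m0 mulr0.
  exact: linear0.
have [e eE] := divD m (f (Sub m mI)) m0; exists e => x.
have [q xE] := mP _ (valP x).
have -> : x = q *: (Sub m mI : submodule I) by apply: val_inj.
by rewrite linearZ /= -eE scalerA.
Qed.

Lemma divisible_fun (X : Type) (D : lmodType int) :
  divisible D -> divisible (X -> D).
Proof.
move=> divD n d n0; have [e eE] := choice (fun x => divD n (d x) n0).
by exists e; apply/funext => x; rewrite -eE.
Qed.

(* Take [D = Q/Z] and extend [n *: a |-> n / k], where [k] is the order of [a],
   or [2] if that order is infinite. *)
Lemma divisible_cogenerator :
  exists D : lmodType int, divisible D /\
    forall (A : lmodType int) (a : A), a != 0 ->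
      exists f : {linear A -> D}, f a != 0.
Proof.
have [||Z ZE] := @submod_of_pred int (zmodule rat)
    (fun x => exists n : int, x = n%:~R).
- by exists 0.
- move=> a _ _ [m ->] [n ->]; exists (a * m + n).
  by rewrite rmorphD rmorphM /= scalezrE -mulrzl.
have [D [p [p_surj kerp]]] := quotient_module Z.
have divD : divisible D.
  move=> n d n0; have [x <-] := p_surj d.
  exists (p (x / n%:~R)); rewrite -linearZ; congr (p _).
  by rewrite scalezrE -mulrzl mulrC divfK ?intr_eq0.
exists D; split=> // A a a0.
have [i iE] : exists i : {linear int^o -> A}, i =1 fun n => (n : int) *: a.
  by apply: linear_funP => x m n; rewrite scalerDl scalerA.
have [||K KE] := @submod_of_pred int int^o (fun n => (n : int) *: a = 0).
- exact: scale0r.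
- by move=> x m n ma na; rewrite scalerDl -scalerA ma na scaler0 addr0.
have [m mK mP] := int_submod_principal K.
pose k : int := if m == 0 then 2 else m.
have k0 : k != 0 by rewrite /k; case: (eqVneq m 0).
(* The image of [1 / k] in [Q/Z] is nonzero: [2] is not a unit, and a unit annihilating [a] would
   force [a = 0]. *)
have k1 : ~ exists n : int, (k%:~R)^-1 = n%:~R :> rat.
  move=> [n kn].
  have kn1 : n * k = 1.
    by apply/eqP; rewrite -(eqr_int rat) rmorphM /= -kn mulVf ?intr_eq0.
  move: kn1; rewrite /k; case: (eqVneq m 0) => [_|m0] kn1.
    have := congr1 absz kn1; rewrite abszM => /eqP.
    by rewrite muln_eq1 andbF.
  case/eqP: a0; rewrite -[a]scale1r -kn1 -scalerA.
  by move/KE: mK => ->; rewrite scaler0.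
have [f fE] : exists f : {linear int^o -> D},
    f =1 fun n => p ((n : int)%:~R / k%:~R).
  apply: linear_funP => x u v; rewrite -linearP; congr (p _).
  by rewrite scalezrE -[(_ / _) *~ x]mulrzl rmorphD rmorphM /= mulrDl mulrA.
have [|h hE] := baer_extend (divisible_baer divD) (i := i) (f := f).
  move=> n; rewrite iE fE => /KE/mP[q ->]; apply/kerp/ZE.
  rewrite /k; case: (eqVneq m 0) => [->|m0]; first by exists 0; rewrite mulr0 mul0r.
  by exists q; rewrite rmorphM /= mulfK ?intr_eq0.
exists h; apply/eqP => ha0; apply: k1; apply/ZE/kerp.
have := hE 1; rewrite iE fE scale1r ha0 => ->.
by rewrite mul1r.
Qed.

(** Evaluation embeds [A] in a power of the cogenerator [D], indexed by all characters [A -> D],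
    since these separate points. *)
Lemma embedding_in_divisible (A : lmodType int) :
  exists (G : lmodType int) (j : {linear A -> G}), divisible G /\ injective j.
Proof.
have [D [divD sepD]] := divisible_cogenerator.
have [j jE] : exists j : {linear A -> ({linear A -> D} -> D)},
    j =1 fun a chi => chi a.
  by apply: linear_funP => n x y; apply/funext => chi; rewrite linearP.
exists ({linear A -> D} -> D), j; split; first exact: divisible_fun.
move=> x y; rewrite !jE => xy; apply/eqP; rewrite -subr_eq0.
apply: contrapT => /negP /sepD[chi]; rewrite linearB.
by rewrite (congr1 (fun F => F chi) xy) subrr eqxx.
Qed.

Lemma additive_linear_int (A B : lmodType int) (f : A -> B) :
  (forall x y, f (x + y) = f x + f y) -> exists h : {linear A -> B}, h =1 f.
Proof.
move=> fD; have f0 : f 0 = 0 by apply: (addrI (f 0)); rewrite -fD !addr0.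
have fN x : f (- x) = - f x by apply: (addrI (f x)); rewrite -fD !subrr.
apply: linear_funP => n x y; rewrite fD; congr (_ + _).
have fnat (k : nat) : f ((k : int) *: x) = (k : int) *: f x.
  elim: k => [|k IHk]; first by rewrite !scale0r.
  by rewrite intS !scalerDl !scale1r fD IHk.
by case: (intP n) => [|k|k]; rewrite ?scaleNr ?fN ?fnat // !scale0r.
Qed.

End DivisibleGroups.

(** * Enough injectives, by coinduction from abelian groups *)

Section EnoughInjectives.
Variable R : pzRingType.

Section Coinduced.
Variable G : lmodType int.

Definition additive_fun : {pred R -> G} :=
  fun f => `[< forall x y, f (x + y) = f x + f y >].

Lemma additive_fun_zmod_closed : zmod_closed additive_fun.
Proof.
split=> [|f g /asboolP fD /asboolP gD]; apply/asboolP => x y.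
  by rewrite addr0.
change (f (x + y) - g (x + y) = (f x - g x) + (f y - g y)).
by rewrite fD gD opprD addrACA.
Qed.
HB.instance Definition _ :=
  GRing.isZmodClosed.Build (R -> G) additive_fun additive_fun_zmod_closed.

(** This is [Hom_Z(R, G)]; right multiplication on the argument will make it a left module. *)
Definition coind : Type := {f : R -> G | f \in additive_fun}.
HB.instance Definition _ := SubChoice.on coind.
HB.instance Definition _ := [SubChoice_isSubZmodule of coind by <:].

Lemma coindD (f : coind) : {morph val f : x y / x + y}.
Proof. by move=> x y; move: x y; exact/asboolP/(valP f). Qed.

Lemma coind_scale_subproof (a : R) (f : coind) :
  (fun x => val f (x * a)) \in additive_fun.
Proof. by apply/asboolP => x y; rewrite mulrDl coindD. Qed.

Definition coind_scale (a : R) (f : coind) : coind :=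
  Sub (fun x => val f (x * a)) (coind_scale_subproof a f).

Lemma coind_eq (f g : coind) : (forall x, val f x = val g x) -> f = g.
Proof. by move=> fg; apply/val_inj/funext. Qed.

Lemma coind_scaleA a b f : coind_scale a (coind_scale b f) = coind_scale (a * b) f.
Proof. by apply: coind_eq => x; rewrite /= mulrA. Qed.

Lemma coind_scale1 : left_id 1 coind_scale.
Proof. by move=> f; apply: coind_eq => x; rewrite /= mulr1. Qed.

Lemma coind_scaleDr : right_distributive coind_scale +%R.
Proof. by move=> a f g; apply: coind_eq => x. Qed.

Lemma coind_scaleDl f : {morph coind_scale^~ f : a b / a + b}.
Proof. by move=> a b; apply: coind_eq => x; rewrite /= mulrDr coindD. Qed.

HB.instance Definition _ := GRing.Zmodule_isLmodule.Build R coind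
  coind_scaleA coind_scale1 coind_scaleDr coind_scaleDl.

Lemma coindZE a (f : coind) x : val (a *: f) x = val f (x * a).
Proof. by []. Qed.

(* [Hom_R(M, Hom_Z(R, G)) = Hom_Z(M, G)]. *)
Lemma coind_baer : divisible G -> baer_injective coind.
Proof.
move=> divG I f.
have [i iE] : exists i : {linear zmodule (submodule I) -> zmodule R},
    i =1 fun x => val (x : submodule I).
  by apply: additive_linear_int.
have [g gE] : exists g : {linear zmodule (submodule I) -> G},
    g =1 fun x => val (f x) 1.
  by apply: additive_linear_int => x y; rewrite linearD.
have [|h hE] := baer_extend (divisible_baer divG) (i := i) (f := g).
  move=> x; rewrite iE gE => x0.
  by have -> : x = 0; [exact: val_inj | rewrite linear0].
have hadd : (h : R -> G) \in additive_fun by apply/asboolP => x y; rewrite linearD.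
(* The extension [h] of [x |-> f x 1] is the witness: [f x y = (y *: f x) 1 = f (y *: x) 1 = h (y *
   x)]. *)
exists (Sub (h : R -> G) hadd) => x; apply: coind_eq => y.
have := hE (y *: x); rewrite iE gE => hyx.
change (val (f x) y = h (y * val x)).
by rewrite [RHS]hyx [f (y *: x)]linearZ [RHS]coindZE mul1r.
Qed.

End Coinduced.

(** Embed the underlying group in a divisible [G] by [j] and send [m] to [x |-> j (x *: m)];
    evaluation at [1] shows injectivity. *)
Lemma enough_injectives (M : lmodType R) :
  exists (E : lmodType R) (i : {linear M -> E}), injective_module E /\ injective i.
Proof.
have [G [j [divG inj_j]]] := embedding_in_divisible (zmodule M).
have jadd (m : M) : (fun x => j (x *: m)) \in @additive_fun G.
  by apply/asboolP => x y; rewrite scalerDl linearD.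
have [i iE] : exists i : {linear M -> coind G},
    i =1 fun m => Sub (fun x => j (x *: m)) (jadd m).
  apply: linear_funP => a m n; apply: coind_eq => x /=.
  by rewrite scalerDr linearD scalerA.
exists (coind G), i; split; first exact/baer_is_injective/coind_baer.
move=> m n; rewrite !iE => /(congr1 (fun f => val f 1)) /=.
by rewrite !scale1r => /inj_j.
Qed.

End EnoughInjectives.

(** * Injective modules over a left hereditary ring *)

Section Hereditary.
Variable R : pzRingType.
Hypothesis hR : left_hereditary R.

(** A map from a left ideal to [Q] lifts to [E], the ideal being projective; there Baer's condition
    applies, and its element is pushed down to [Q]. *)
Lemma injective_quotient (E Q : lmodType R) (p : {linear E -> Q}) :
  injective_module E -> (forall y, exists x, p x = y) -> injective_module Q.
Proof.
move=> injE p_surj; apply: baer_is_injective => I f.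
have [h hE] := hR f p_surj.
have [e eE] := injective_is_baer injE h.
by exists (p e) => x; rewrite -hE eE linearZ.
Qed.

(** The envelope is a quotient of an injective [E0] containing [R], by a submodule [T] maximal among
    those meeting [R] trivially: heredity keeps it injective, and maximality makes [R] essential in
    it. *)
Lemma ring_injective_envelope :
  exists (E : lmodType R) (i : {linear R^o -> E}), injective_envelope i.
Proof.
have [E0 [i0 [injE0 inj_i0]]] := enough_injectives R^o.
have [||Z ZE] := @submod_of_pred R E0 (fun x => x = 0).
- by [].
- by move=> a x y -> ->; rewrite scaler0 addr0.
have [|T [_ avT Tmax]] := @maximal_avoiding R E0 Z
    (fun v => v <> 0 /\ exists x, v = i0 x).
  by move=> x /ZE -> [].
have [E [p [p_surj kerp]]] := quotient_module T.
exists E, (p \o i0); split.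
- exact: injective_quotient injE0 p_surj.
- move=> x y /= pxy; apply/eqP; rewrite -subr_eq0; apply/eqP/inj_i0.
  rewrite linear0; apply: contrapT => xy0.
  have : i0 (x - y) \in T by apply/kerp; rewrite !linearB pxy subrr.
  by move/avT; apply; split=> //; exists (x - y).
- move=> S [y yS y0]; have [v vy] := p_surj y.
  have [|t [a [tT [tav0 [x xE]]]]] := Tmax v.
    by apply/negP => /kerp v0; case/eqP: y0; rewrite -vy.
  have pt : p t = 0 by apply/kerp.
  have pE : p (i0 x) = a *: y by rewrite -xE linearD linearZ pt add0r /= vy.
  exists x => /=; first by rewrite pE rpredZ.
  apply/eqP => /kerp; rewrite -xE => /avT; apply; split=> //.
  by exists x.
Qed.

End Hereditary.

(** * Uses of the factorization system and of the chain condition *)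

(** The retraction is the diagonal of the square with [f] on two opposite sides and identities on
    the others. *)
Lemma fs_epi_mono_retraction (C : category) :
  factorization_system (@is_epi C) (@is_mono C) ->
  forall (A B : C) (f : Defs.hom A B), is_epi f -> is_mono f ->
  exists g : Defs.hom B A, ccomp g f = Defs.cid A.
Proof.
move=> fs A B f epi_f mono_f.
have [|g [[gf _] _]] := fs_diagonal fs (a := Defs.cid A) (b := Defs.cid B) epi_f mono_f.
  by rewrite cid_left cid_right.
by exists g.
Qed.

(** Without a minimal member, choice builds a strictly descending sequence of direct summands. *)
Lemma dcc_minimal_summand (R : pzRingType) (V : lmodType R)
    (Q : submodClosed V -> Prop) :
  dcc_direct_summands V -> (forall S, Q S -> direct_summand S) ->
  (exists S, Q S) ->
  exists2 S, Q S & forall T, Q T -> {subset T <= S} -> {subset S <= T}.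
Proof.
move=> dcc Qsum [S0 QS0]; apply: contrapT => nomin.
have step (S : {S | Q S}) : exists T : {T | Q T},
    {subset sval T <= sval S} /\ ~ {subset sval S <= sval T}.
  case: S => S QS /=; apply: contrapT => noT; apply: nomin; exists S => // T QT TS.
  by apply: contrapT => ST; apply: noT; exists (exist _ T QT).
have [next nextP] := choice step.
pose s n := iter n next (exist _ S0 QS0).
have [n nP] : exists n, forall m, (n <= m)%N -> sval (s m) =i sval (s n).
  by apply: dcc => n; [exact/Qsum/(svalP (s n)) | case: (nextP (s n))].
have [_] := nextP (s n); apply=> x.
by rewrite -(nP n.+1 (leqnSn n)).
Qed.

(** * Projectivity of the injective envelope *)

Section Envelope.
Variables (R : pzRingType) (hR : left_hereditary R).
Variables (E : lmodType R) (i : {linear R^o -> E}).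
Hypothesis envE : injective_envelope i.

Definition trace_kernel (S : submodClosed R^o) : Prop :=
  exists (P : lmodType R) (q : {linear E -> P}),
    projective_module P /\ forall r, r \in S <-> q (i r) = 0.

Lemma image_submod (S : submodClosed R^o) :
  exists iS : submodClosed E, forall x, x \in iS <-> exists2 r, r \in S & x = i r.
Proof.
apply: submod_of_pred => [|a _ _ [r rS ->] [s sS ->]].
  by exists 0; rewrite ?rpred0 ?linear0.
by exists (a *: r + s); rewrite ?rpredD ?rpredZ ?linearP.
Qed.

(* Write [S = ker (q i)]. Extending [q i r |-> p (i r)] to the injective module
   [E / i(S)] and lifting it along [p] yields [h] such that [h q i] is, up to
   [i], an idempotent of [R] with kernel [S]. *)
Lemma trace_kernel_summand (S : submodClosed R^o) :
  trace_kernel S -> direct_summand S.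
Proof.
move=> [P [q [projP SE]]].
have [iS iSE] := image_submod S.
have [Q [p [p_surj kerp]]] := quotient_module iS.
have [injE inj_i _] := envE.
have injQ := injective_quotient hR injE p_surj.
have [|g gE] := baer_extend (injective_is_baer injQ) (i := q \o i) (f := p \o i).
  by move=> r /= /SE rS; apply/kerp/iSE; exists r.
have [h hE] := projP _ _ p g p_surj.
have sigma_ex r : exists s, i s = h (q (i r)) /\ r - s \in S.
  have : i r - h (q (i r)) \in iS.
    by apply/kerp; rewrite linearB hE [g _]gE subrr.
  move=> /iSE[t tS rt]; exists (r - t); split; last by rewrite opprB addrC subrK.
  by rewrite linearB -rt opprB addrC subrK.
(* The complement of [S] consists of the elements fixed by the idempotent. *)
have [||T TE] := @submod_of_pred R R^o (fun x => i x = h (q (i x))).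
- by rewrite !linear0.
- by move=> a x y xE yE; rewrite !linearP -xE -yE.
exists T; split=> [x /SE qx /TE|r].
  by rewrite qx linear0 -(linear0 i) => /inj_i.
have [s [sE rsS]] := sigma_ex r; exists (r - s), s; split=> //.
  apply/TE; rewrite [LHS]sE; congr (h _).
  by apply/eqP; rewrite -subr_eq0 -!linearB; apply/eqP/SE.
by rewrite subrK.
Qed.

Lemma trace_kernel_ker (P : lmodType R) (q : {linear E -> P}) :
  projective_module P ->
  exists2 S, trace_kernel S & forall r, r \in S <-> q (i r) = 0.
Proof.
move=> projP.
have [||S SE] := @submod_of_pred R R^o (fun r => q (i r) = 0).
- by rewrite !linear0.
- by move=> a x y xE yE; rewrite !linearP xE yE scaler0 addr0.
by exists S => //; exists P, q.
Qed.

(** The kernel of [q] meets [i(R)] trivially, so it is zero by essentiality; injectivity of [E] then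
    splits [q], and [E] is a direct summand of [P]. *)
Lemma kernel_zero_projective (P : lmodType R) (q : {linear E -> P}) :
  projective_module P -> (forall r, q (i r) = 0 -> r = 0) -> projective_module E.
Proof.
move=> projP qi0; have [injE _ ess] := envE.
have inj_q : injective q.
  have [||K KE] := @submod_of_pred R E (fun x => q x = 0).
  - exact: linear0.
  - by move=> a x y xE yE; rewrite !linearP xE yE scaler0 addr0.
  move=> x y qxy; apply/eqP; rewrite -subr_eq0; apply: contrapT => /negP xy0.
  have [|r /KE/qi0 -> ] := ess K; last by rewrite linear0 eqxx.
  by exists (x - y) => //; apply/KE; rewrite linearB qxy subrr.
have [r rE] := injE _ _ q idfun inj_q.
move=> M N g f g_surj.
have [h hE] := projP _ _ g (f \o r) g_surj.
by exists (h \o q) => x; rewrite /= hE /= rE.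
Qed.

Lemma envelope_projective :
  factorization_system (@is_epi (stable_category R)) (@is_mono (stable_category R)) ->
  dcc_direct_summands R^o -> projective_module E.
Proof.
move=> hfs dcc; have [_ inj_i _] := envE.
have [|S [P [q [projP SE]]] Smin] :=
    dcc_minimal_summand dcc trace_kernel_summand.
  (* The zero map shows that the family of trace kernels is nonempty. *)
  have [z _] : exists z : {linear E -> 'rV[R]_0}, z =1 fun=> 0.
    by apply: linear_funP => a x y; rewrite scaler0 addr0.
  by have [S trS _] := trace_kernel_ker z (@projective0 R); exists S.
(* The trace kernel of the pair [(q, u)] lies in [S], hence equals [S] by minimality. *)
have kill (P' : lmodType R) (u : {linear E -> P'}) : projective_module P' ->
    forall r, r \in S -> u (i r) = 0.
  move=> projP'.
  have [v vE] : exists v : {linear E -> (P * P')%type}, v =1 fun x => (q x, u x).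
    by apply: linear_funP => a x y; rewrite !linearP.
  have [T trT TE] := trace_kernel_ker v (projective_prod projP projP').
  move=> r /(Smin T trT) rT; have : v (i r) = (0, 0).
    by apply/TE/rT => t /TE; rewrite vE => -[/SE].
  by rewrite vE => -[].
have [iS iSE] := image_submod S.
have [Q [p [p_surj kerp]]] := quotient_module iS.
have mono_p : is_mono (C := stable_category R) (stable_class p).
  move=> D g h /=; rewrite -[g]stable_reprK -[h]stable_reprK.
  move: (stable_repr g) (stable_repr h) => {}g {}h.
  rewrite !stable_comp_class => /stable_class_eq[P1 [u [w [projP1 pgh]]]].
  apply/stable_class_eq.
  (* Once [w] is lifted along [p], the difference [g - h - w' u] takes values in [i(S)], a copy of
     the projective [S]. *)
  have [w' w'E] := projP1 _ _ p w p_surj.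
  pose d : {linear D -> E} := ((g \- h) \- (w' \o u)).
  have rE x : exists s : submodule S, d x = i (val s).
    have : d x \in iS by apply/kerp; rewrite !linearB w'E -pgh /= subrr.
    by move=> /iSE[r rS ->]; exists (Sub r rS).
  have [f fE] := choice rE.
  have [k kE] : exists k : {linear D -> submodule S}, k =1 f.
    apply: linear_funP => a x y; apply/val_inj/inj_i.
    rewrite -fE linearP !fE -linearP; congr (i _).
  have [j jE] : exists j : {linear submodule S -> E}, j =1 fun s => i (val s).
    by apply: linear_funP => a x y; rewrite !linearP.
  have : factors_through_projective (fun x => w' (u x)) by exists P1, u, w'.
  have : factors_through_projective (fun x => j (k x)).
    by exists (submodule S), k, j; split=> //; exact: hR.
  move=> f1 f2; have := ftp_add f1 f2; apply: ftp_eq => x.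
  by rewrite jE kE -fE /= subrK.
have epi_p : is_epi (C := stable_category R) (stable_class p).
  move=> D g h /=; rewrite -[g]stable_reprK -[h]stable_reprK.
  move: (stable_repr g) (stable_repr h) => {}g {}h.
  rewrite !stable_comp_class => /stable_class_eq[P1 [u [w [projP1 ghp]]]].
  apply/stable_class_eq.
  (* By [kill], [u] vanishes on the kernel of [p], so it descends to [k] on [Q], built from a
     set-theoretic section; then [g - h = w k]. *)
  have [sec secE] := choice p_surj.
  have uker x : p x = 0 -> u x = 0.
    by move=> /kerp/iSE[r rS ->]; apply: kill.
  have usec x : u (sec (p x)) = u x.
    by apply/eqP; rewrite -subr_eq0 -linearB; apply/eqP/uker; rewrite linearB secE subrr.
  have [k kE] : exists k : {linear Q -> P1}, k =1 u \o sec.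
    apply: linear_funP => a x y /=; rewrite -linearP.
    apply/eqP; rewrite -subr_eq0 -linearB; apply/eqP/uker.
    by rewrite linearB linearP !secE subrr.
  exists P1, k, w; split=> // y; have [x <-] := p_surj y.
  by rewrite kE /= usec -ghp.
have [g /= ] := fs_epi_mono_retraction hfs epi_p mono_p.
rewrite -[g]stable_reprK; move: (stable_repr g) => {}g.
rewrite stable_comp_class => /stable_class_eq[P1 [u [w [projP1 gp]]]].
(* At [i r] with [r] in [S], both [p] and [u] vanish, so [g p - id = w u] reads [- i r = 0]. *)
apply: (kernel_zero_projective projP (q := q)) => r /SE rS.
apply: inj_i; rewrite linear0.
have := gp (i r); rewrite /= (kill _ u projP1 r rS) linear0.
have -> : p (i r) = 0 by apply/kerp/iSE; exists r.
by rewrite linear0 sub0r => /eqP; rewrite oppr_eq0 => /eqP.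
Qed.

End Envelope.

Theorem proposition8p15 (R : pzRingType) (hR : left_hereditary R)
    (hfs : factorization_system (@is_epi (stable_category R))
                                (@is_mono (stable_category R))) :
  (exists (E : lmodType R) (i : {linear R^o -> E}),
      injective_envelope i /\ projective_module E) \/
  ~ dcc_direct_summands R^o.
Proof.
have [dcc|] := pselect (dcc_direct_summands R^o); last by right.
left; have [E [i envE]] := ring_injective_envelope hR.
by exists E, i; split=> //; exact: envelope_projective envE hfs dcc.
Qed.
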